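(* Let $V\sim N(\mu,\Sigma)$ be a Gaussian random vector with positive definite covariance matrix $\Sigma$, let $a\ne c$ and $z$ be components of $V$ and $B$ a set of components of $V$, with $a,c\notin B\cup\{z\}$. Suppose $a\perp\!\!\!\perp c$ and that for some component $x$ of $V$, $\{a,c\}\perp\!\!\!\perp B\cup\{z\}\mid x$. Then $$\rho^2_{ac\mid B}\le\rho^2_{ac\mid B\cup\{z\}}.$$ Moreover, if $z'\notin\{a,c\}$ is a component of $V$ with $z'\perp\!\!\!\perp \{a,c\}\cup B\mid z$, then $$\rho^2_{ac\mid B}\le\rho^2_{ac\mid B\cup\{z'\}}\le\rho^2_{ac\mid B\cup\{z\}}.$$
   Context: $X\perp\!\!\!\perp Y\mid W$ denotes conditional independence of the (sub)vectors $X$ and $Y$ given $W$; for components of a Gaussian vector it is equivalent to $\Sigma_{XY}-\Sigma_{XW}\Sigma_{WW}^{-1}\Sigma_{WY}=0$ (this also makes sense if the sets overlap). $X\perp\!\!\!\perp Y$ is unconditional independence. For distinct components $u,v$ and a set $Z$ of components with $u,v\notin Z$, the squared partial correlation is $$\rho^2_{uv\mid Z}=\frac{(\sigma_{uv}-\Sigma_{uZ}\Sigma_{ZZ}^{-1}\Sigma_{Zv})^2}{(\sigma_{uu}-\Sigma_{uZ}\Sigma_{ZZ}^{-1}\Sigma_{Zu})(\sigma_{vv}-\Sigma_{vZ}\Sigma_{ZZ}^{-1}\Sigma_{Zv})},$$ where $\sigma_{uv}$ is the $(u,v)$ entry of $\Sigma$ and $\Sigma_{uZ}$ etc. are submatrices;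 for $Z=\emptyset$ the correction terms are absent. *)

(* Defs.v *)
From HB Require Import structures.
From mathcomp Require Import all_boot all_order all_algebra.
From mathcomp Require Import all_classical all_reals all_analysis.

Set Implicit Arguments.
Unset Strict Implicit.
Unset Printing Implicit Defensive.

Import Order.TTheory GRing.Theory Num.Theory.
Import numFieldNormedType.Exports.

Local Open Scope classical_set_scope.
Local Open Scope ring_scope.

Definition posdefmx (R : realType) (n : nat) (S : 'M[R]_n) : Prop :=
  S^T = S /\ forall t : 'rV[R]_n, t != 0 -> 0 < (t *m S *m t^T) 0 0.

(* The law N(m, v), parametrised by the variance.  The degenerate case is
   separate because [normal_prob m 0] is the uniform law on [0, 1] instead of
   the point mass at [m]. *)
Definition normal_law (R : realType) (m v : R) : set R -> \bar R :=
  if v == 0 then \d_m else normal_prob m (Num.sqrt v).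

(* V ~ N(mu, S): every linear combination t.V has law N(t.mu, t S t^T). *)
Definition gaussian_vector (d : measure_display) (T : measurableType d)
    (R : realType) (P : probability T R) (n : nat)
    (V : 'I_n -> {RV P >-> R}) (mu : 'rV[R]_n) (S : 'M[R]_n) : Prop :=
  forall (t : 'rV[R]_n) (A : set R), measurable A ->
    P ((fun w => \sum_(i < n) t 0 i * V i w) @^-1` A) =
    normal_law ((mu *m t^T) 0 0) ((t *m S *m t^T) 0 0) A.

(* The sigma-algebra sigma(V_i : i in I); it is trivial for empty I. *)
Definition sigma_of (d : measure_display) (T : measurableType d)
    (R : realType) (P : probability T R) (n : nat)
    (V : 'I_n -> {RV P >-> R}) (I : {set 'I_n}) : set (set T) :=
  <<s \bigcup_(i in [set` I])
        preimage_set_system [set: T] (V i) (@measurable _ R) >>.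

(* f is a version of the conditional probability P(A | G), for a
   sub-sigma-algebra G of the measurable sets. *)
Definition is_cond_prob (d : measure_display) (T : measurableType d)
    (R : realType) (P : probability T R) (G : set (set T)) (A : set T)
    (f : T -> R) : Prop :=
  [/\ forall C : set R, measurable C -> G (f @^-1` C),
      P.-integrable [set: T] (EFin \o f)
    & forall D : set T, G D ->
        (\int[P]_(w in D) (f w)%:E)%E = P (A `&` D)].

Definition indep (d : measure_display) (T : measurableType d)
    (R : realType) (P : probability T R) (n : nat)
    (V : 'I_n -> {RV P >-> R}) (I J : {set 'I_n}) : Prop :=
  forall A B : set T, sigma_of V I A -> sigma_of V J B ->
    P (A `&` B) = (P A * P B)%E.

(* V_I and V_J are conditionally independent given V_K:
   P(A /\ B | V_K) = P(A | V_K) P(B | V_K) almost surely for all events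
   A of sigma(V_I) and B of sigma(V_J).  Versions always exist and are
   almost surely unique, so it does not matter that they are bound
   existentially.  I, J and K may overlap. *)
Definition cond_indep (d : measure_display) (T : measurableType d)
    (R : realType) (P : probability T R) (n : nat)
    (V : 'I_n -> {RV P >-> R}) (I J K : {set 'I_n}) : Prop :=
  forall A B : set T, sigma_of V I A -> sigma_of V J B ->
    exists f g h : T -> R,
      [/\ is_cond_prob P (sigma_of V K) A f,
          is_cond_prob P (sigma_of V K) B g,
          is_cond_prob P (sigma_of V K) (A `&` B) h
        & {ae P, forall w, h w = f w * g w}].

(* The partial covariance s_uv - S_uZ S_ZZ^-1 S_Zv; for empty Z the product
   of matrices has inner dimension 0, hence vanishes. *)
Definition pcov (R : realType) (n : nat) (S : 'M[R]_n) (u v : 'I_n)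
    (Z : {set 'I_n}) : R :=
  let SuZ := \row_(j < #|Z|) S u (enum_val j) in
  let SZZ := \matrix_(i < #|Z|, j < #|Z|) S (enum_val i) (enum_val j) in
  let SZv := \col_(i < #|Z|) S (enum_val i) v in
  S u v - (SuZ *m invmx SZZ *m SZv) 0 0.

Definition pcorr2 (R : realType) (n : nat) (S : 'M[R]_n) (u v : 'I_n)
    (Z : {set 'I_n}) : R :=
  pcov S u v Z ^+ 2 / (pcov S u u Z * pcov S v v Z).

(* Main.v *)
From HB Require Import structures.
Require Import Defs.
From mathcomp Require Import all_boot all_order all_algebra.
From mathcomp Require Import all_classical all_reals all_analysis.
From mathcomp Require Import measurable_realfun ring lra.

(* The hypotheses on [V] are first turned into identities between covariances.
   If s.V and t.V are uncorrelated, then for W = s.V and Z = t.V - E[t.V] the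
   laws of W + kZ and W - kZ agree, so k |-> E[(W + kZ - c)^+] is even; its
   derivative at 0 is E[Z; W > c], which therefore vanishes for all c, and
   E[Z | W] = 0.  Conversely, if E[t.V - c | W] = 0, subtract from t.V its
   regression on W: what remains of the identity forces the regression
   coefficient to be 0, because W has no atom.  With Z the residual of V_u
   given V_x, conditional independence of V_u and V_v given V_x yields
   E[Z | V_v] = 0, that is S_uv S_xx = S_ux S_xv.

   These identities make S_cj = g S_aj for all j in the conditioning sets Z,
   and with S_ac = 0 the squared partial correlation becomes
   g^2 w^2 / ((S_aa - w) (S_cc - g^2 w)), where w = w(Z) is the variance of V_a
   explained by V_Z.  This is increasing in w; and w is the maximum of
   2 cov(V_a, t.V) - var(t.V) over the t supported on Z, so it increases with Z
   and cannot increase when z is replaced by its degraded version z'. *)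

Set Implicit Arguments.
Unset Strict Implicit.
Unset Printing Implicit Defensive.

Import Order.TTheory GRing.Theory Num.Theory.
Import numFieldNormedType.Exports.

Local Open Scope ring_scope.

(** * Partial correlations as functions of the explained variance *)

(** If V has covariance matrix S, this is the covariance of s.V and t.V. Linear predictors are
    represented by their coefficient vectors. *)
Definition cov (R : realType) (n : nat) (S : 'M[R]_n) (s t : 'rV[R]_n) : R :=
  (s *m S *m t^T) 0 0.

(** Predictors built from V_Z are kept as vectors of full length n, so that those for different sets
    Z can be compared directly. *)
Definition supported_on (R : realType) (n : nat) (Z : {set 'I_n})
    (t : 'rV[R]_n) : Prop := forall i, i \notin Z -> t 0 i = 0.

Section Covariance.
Variables (R : realType) (n : nat) (S : 'M[R]_n).
Implicit Types (r s t : 'rV[R]_n) (Z : {set 'I_n}) (u v : 'I_n).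

Local Notation e u := (delta_mx 0 u : 'rV[R]_n).

Lemma covDl r s t : cov S (r + s) t = cov S r t + cov S s t.
Proof. by rewrite /cov !mulmxDl mxE. Qed.

Lemma covZl (k : R) s t : cov S (k *: s) t = k * cov S s t.
Proof. by rewrite /cov -!scalemxAl mxE. Qed.

Lemma cov_delta u v : cov S (e u) (e v) = S u v.
Proof. by rewrite /cov -rowE trmx_delta -colE !mxE. Qed.

Hypothesis Spd : posdefmx S.

Lemma covC s t : cov S s t = cov S t s.
Proof.
rewrite /cov -[LHS]trace_mx11 -[RHS]trace_mx11 -mxtrace_tr.
by rewrite !trmx_mul trmxK Spd.1 mulmxA.
Qed.

Lemma covDr r s t : cov S r (s + t) = cov S r s + cov S r t.
Proof. by rewrite covC covDl !(covC r). Qed.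

Lemma covZr (k : R) s t : cov S s (k *: t) = k * cov S s t.
Proof. by rewrite covC covZl covC. Qed.

Lemma cov_gt0 t : t != 0 -> 0 < cov S t t.
Proof. exact: Spd.2. Qed.

Lemma cov_ge0 t : 0 <= cov S t t.
Proof.
have [->|/cov_gt0/ltW//] := eqVneq t 0.
by rewrite /cov !mul0mx mxE.
Qed.

Lemma delta_neq0 u : e u != 0.
Proof.
apply/negP => /eqP/rowP/(_ u); rewrite !mxE !eqxx => /eqP.
by rewrite oner_eq0.
Qed.

Lemma posdef_diag_gt0 u : 0 < S u u.
Proof. by rewrite -cov_delta; apply/cov_gt0/delta_neq0. Qed.

Lemma posdef_sym u v : S u v = S v u.
Proof. by rewrite -!cov_delta covC. Qed.

(** The rows are the unit vectors indexed by Z, so the submatrices in [pcov] become products of S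
    with this matrix and its transpose. *)
Definition select_mx Z : 'M[R]_(#|Z|, n) :=
  \matrix_(j, i) (i == enum_val j)%:R.

Lemma select_mxE m (A : 'M[R]_(n, m)) Z :
  select_mx Z *m A = \matrix_(j, k) A (enum_val j) k.
Proof.
apply/matrixP => j k; rewrite !mxE (bigD1 (enum_val j))//= big1 => [|i /negbTE ij].
  by rewrite mxE eqxx mul1r addr0.
by rewrite mxE ij mul0r.
Qed.

Lemma mul_select_mxT m (A : 'M[R]_(m, n)) Z :
  A *m (select_mx Z)^T = \matrix_(k, j) A k (enum_val j).
Proof.
apply: trmx_inj; rewrite trmx_mul trmxK select_mxE.
by apply/matrixP => j k; rewrite !mxE.
Qed.

Lemma supported_sum Z t : supported_on Z t -> t = \sum_(i in Z) t 0 i *: e i.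
Proof.
move=> tZ; rewrite [LHS]row_sum_delta [RHS]big_mkcond /=; apply: eq_bigr => i _.
by case: ifPn => // /tZ ->; rewrite scale0r.
Qed.

Lemma cov_suml (I : finType) (Q : pred I) (F : I -> 'rV[R]_n) t :
  cov S (\sum_(i | Q i) F i) t = \sum_(i | Q i) cov S (F i) t.
Proof. by rewrite /cov !mulmx_suml summxE. Qed.

Lemma cov_supported_eq Z r s t : supported_on Z t ->
  (forall i, i \in Z -> cov S (e i) r = cov S (e i) s) ->
  cov S t r = cov S t s.
Proof.
move=> /supported_sum -> rs; rewrite !cov_suml; apply: eq_bigr => i iZ.
by rewrite !covZl rs.
Qed.

Lemma supported_select Z (y : 'rV[R]_#|Z|) : supported_on Z (y *m select_mx Z).
Proof.
move=> i iZ; rewrite mxE big1// => j _; rewrite mxE.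
have -> : (i == enum_val j) = false; last by rewrite mulr0.
by apply/negbTE; apply: contraNneq iZ => ->; exact: enum_valP.
Qed.

Lemma select_mx_inj Z (y : 'rV[R]_#|Z|) : y *m select_mx Z = 0 -> y = 0.
Proof.
move=> /(congr1 (fun x => x *m (select_mx Z)^T)).
rewrite mul0mx -mulmxA mul_select_mxT.
rewrite (_ : (\matrix_(_, _) _) = 1%:M) ?mulmx1//.
apply/matrixP => i j; rewrite !mxE eq_sym; congr (_%:R).
by rewrite (inj_eq enum_val_inj).
Qed.

(** A left kernel vector y gives a combination y L of variance 0; positive definiteness forces y L =
    0, hence y = 0. So [invmx] in [pcov] is a true inverse. *)
Lemma select_mx_unit Z : select_mx Z *m S *m (select_mx Z)^T \in unitmx.
Proof.
rewrite -row_free_unit; set M := (X in row_free X).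
rewrite -kermx_eq0; apply/eqP/row_matrixP => i; rewrite row0.
set y := row i _; apply: select_mx_inj; apply/eqP; apply: contraT => /cov_gt0.
have yM : y *m M = 0 by apply/sub_kermxP; exact: row_sub.
rewrite /cov trmx_mul !mulmxA -(mulmxA y) -(mulmxA y) -/M yM.
by rewrite mul0mx mxE ltxx.
Qed.

(* [r] is the best linear predictor of V_u in terms of V_Z. *)
Lemma regressionP u Z : exists r : 'rV[R]_n,
  [/\ supported_on Z r, forall j, j \in Z -> cov S r (e j) = S u j
    & forall v, pcov S u v Z = S u v - cov S r (e v)].
Proof.
set L := select_mx Z; set M := L *m S *m L^T.
(* The row S_uZ S_ZZ^-1, extended by zeros outside Z. *)
exists (e u *m S *m L^T *m invmx M *m L); split.
- exact: supported_select.
- move=> j jZ; have jE : e j = delta_mx 0 (enum_rank_in jZ j) *m L.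
    apply/rowP => i; rewrite -rowE !mxE eqxx/= enum_rankK_in//.
  rewrite -[in RHS]cov_delta /cov jE trmx_mul !mulmxA.
  by rewrite -(mulmxA _ L) -(mulmxA _ (L *m S)) -/M mulmxKV// select_mx_unit.
- move=> v; rewrite /pcov /cov -(mulmxA _ L S) -(mulmxA _ (L *m S)).
  congr (_ - (_ *m invmx _ *m _) _ _).
  + by rewrite mul_select_mxT -rowE; apply/rowP => j; rewrite !mxE.
  + by rewrite /M mul_select_mxT select_mxE; apply/matrixP => i j; rewrite !mxE.
  + rewrite -mulmxA select_mxE trmx_delta -colE.
    by apply/colP => i; rewrite !mxE.
Qed.

(** The partial variance is the variance of the residual e_u - r, which is nonzero because its
    coefficient at u is 1. *)
Lemma pcov_gt0 u Z : u \notin Z -> 0 < pcov S u u Z.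
Proof.
move=> uZ; have [r [rZ rS ->]] := regressionP u Z.
have rr : cov S r r = cov S r (e u).
  by apply: (cov_supported_eq rZ) => i iZ; rewrite covC rS// cov_delta posdef_sym.
rewrite -cov_delta (_ : _ - _ = cov S (e u + (-1) *: r) (e u + (-1) *: r)).
  apply: cov_gt0; apply/eqP => /rowP/(_ u).
  by rewrite !mxE !eqxx rZ// mulr0 addr0 => /eqP; rewrite oner_eq0.
by rewrite !(covDl, covDr, covZl, covZr) rr (covC (e u) r); ring.
Qed.

(** The variance S_uZ S_ZZ^-1 S_Zu of the best linear predictor of V_u from V_Z. *)
Definition explained u Z : R := S u u - pcov S u u Z.

(** With r the regression of V_u on V_Z, the difference of the two sides is the variance of r.V -
    t.V. Together with [explained_attained] this describes the explained variance as a maximum over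
    predictors. *)
Lemma explained_ge u Z t : supported_on Z t ->
  2 * cov S (e u) t - cov S t t <= explained u Z.
Proof.
move=> tZ; rewrite /explained; have [r [rZ rS ->]] := regressionP u Z.
have eur s : supported_on Z s -> cov S s r = cov S s (e u).
  move=> sZ; apply: (cov_supported_eq sZ) => i iZ.
  by rewrite covC rS// cov_delta posdef_sym.
have := cov_ge0 (r + (-1) *: t).
rewrite !(covDl, covDr, covZl, covZr) (covC r t) !eur// (covC (e u) t).
lra.
Qed.

Lemma explained_attained u Z : exists2 t, supported_on Z t &
  explained u Z = 2 * cov S (e u) t - cov S t t.
Proof.
rewrite /explained; have [r [rZ rS ->]] := regressionP u Z; exists r => //.
rewrite (@cov_supported_eq Z r (e u) r) ?(covC (e u))//; first lra.
by move=> i iZ; rewrite covC rS// cov_delta posdef_sym.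
Qed.

Lemma explained_ge0 u Z : 0 <= explained u Z.
Proof.
apply: le_trans (@explained_ge u Z 0 _); last by move=> i _; rewrite mxE.
by rewrite -(scale0r (0 : 'rV_n)) covZr covZl !mul0r mulr0 subr0.
Qed.

Lemma le_explained u Z1 Z2 :
  (forall t, supported_on Z1 t -> exists2 t', supported_on Z2 t' &
     2 * cov S (e u) t - cov S t t <= 2 * cov S (e u) t' - cov S t' t') ->
  explained u Z1 <= explained u Z2.
Proof.
move=> h; have [t tZ ->] := explained_attained u Z1.
have [t' tZ' /le_trans] := h _ tZ; apply; exact: explained_ge.
Qed.

Lemma explained_subset u Z1 Z2 : Z1 \subset Z2 ->
  explained u Z1 <= explained u Z2.
Proof.
move=> Z12; apply: le_explained => t tZ; exists t => // i iZ2.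
by apply: tZ; apply: contra iZ2; exact: (fintype.subsetP Z12).
Qed.

(* If V_z' depends on V_u and V_B only through V_z, replacing V_z' by its
   regression on V_z in a predictor of V_u can only help. *)
Lemma explained_degraded u z z' B :
  (forall j, j \in u |: B -> S z' j * S z z = S z' z * S z j) ->
  explained u (z' |: B) <= explained u (z |: B).
Proof.
move=> hz'; apply: le_explained => t tB.
(* The residual of V_z' given V_z; the hypothesis makes it uncorrelated with V_u and V_B, and it is
   always uncorrelated with V_z. *)
pose eps : 'rV[R]_n := e z' + (- (S z' z / S z z)) *: e z.
have Szz := posdef_diag_gt0 z.
have eps0 j : j \in z |: (u |: B) -> cov S (e j) eps = 0.
  move=> jB; rewrite covC covDl covZl !cov_delta.
  have -> : S z' j = S z' z * S z j / S z z.
    move: jB; rewrite in_setU1 => /predU1P[->|/hz' <-].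
      by rewrite mulfK// gt_eqF.
    by rewrite mulfK// gt_eqF.
  by ring.
(* Removing the [eps] part moves the weight of z' onto z. The covariance with V_u is unchanged,
   while the variance drops by that of the removed part. *)
pose t' : 'rV[R]_n := t + (- t 0 z') *: eps.
have t'B : supported_on (z |: B) t'.
  move=> i; rewrite in_setU1 negb_or => /andP[iz iB].
  rewrite !mxE !eqxx /= (negbTE iz) mulr0 addr0.
  have [->|iz'] /= := eqVneq i z'; first by rewrite mulr1 addrN.
  by rewrite mulr0 addr0 tB// in_setU1 negb_or iz'.
exists t' => //.
have tE : t = t' + t 0 z' *: eps by rewrite /t' scaleNr addrNK.
have ueps : cov S (e u) eps = 0 by rewrite eps0// !inE eqxx orbT.
have t'eps : cov S t' eps = 0.
  have /supported_sum -> := t'B; rewrite cov_suml big1// => i iB.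
  rewrite covZl eps0 ?mulr0//.
  by move: iB; rewrite !inE => /orP[->//|->]; rewrite !orbT.
clearbody t'; clearbody eps.
rewrite tE !(covDl, covDr, covZl, covZr) ueps t'eps (covC eps) t'eps.
have := mulr_ge0 (sqr_ge0 (t 0 z')) (cov_ge0 eps); rewrite expr2.
lra.
Qed.

(** Every predictor supported on Z has g times as much covariance with V_c as with V_a, so the
    correction term gains a factor g for each occurrence of c. *)
Lemma pcov_proportional (a c : 'I_n) (g : R) Z :
  (forall j, j \in Z -> S c j = g * S a j) ->
  pcov S a c Z = S a c - g * explained a Z /\
  pcov S c c Z = S c c - g ^+ 2 * explained a Z.
Proof.
move=> cga; rewrite /explained.
have [r [rZ rS rp]] := regressionP a Z; have [q [qZ qS qp]] := regressionP c Z.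
have ra s : supported_on Z s -> cov S s r = cov S s (e a).
  move=> sZ; apply: (cov_supported_eq sZ) => i iZ.
  by rewrite covC rS// cov_delta posdef_sym.
have rc s : supported_on Z s -> cov S s (e c) = g * cov S s (e a).
  move=> sZ; rewrite -covZr; apply: (cov_supported_eq sZ) => i iZ.
  by rewrite covZr !cov_delta !(posdef_sym i) cga.
have qc : cov S q (e a) = cov S r (e c).
  rewrite -ra// covC; apply: (cov_supported_eq rZ) => i iZ.
  by rewrite covC qS// cov_delta posdef_sym.
by rewrite !rp !qp !rc// qc !rc//; split; ring.
Qed.

(** The regression of V_a on V_Z has variance 0, hence vanishes, and the numerator reduces to S_ac.
    This covers the case where no ratio g between c and a can be formed. *)
Lemma pcorr2_uncorrelated (a c : 'I_n) Z : S a c = 0 ->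
  (forall j, j \in Z -> S a j = 0) -> pcorr2 S a c Z = 0.
Proof.
move=> ac0 aZ; rewrite /pcorr2.
have [r [rZ rS ->]] := regressionP a Z.
suff -> : r = 0 by rewrite ac0 /cov !mul0mx mxE subrr expr0n mul0r.
apply/eqP; apply: contraT => /cov_gt0.
have /supported_sum {2}-> := rZ; rewrite covC cov_suml big1 ?ltxx// => i iZ.
by rewrite covZl covC rS// aZ// mulr0.
Qed.

(** As the explained variance grows, the numerator grows and both factors of the denominator shrink;
    these factors stay positive because they are partial variances. *)
Lemma pcorr2_le (a c : 'I_n) (g : R) Z1 Z2 : S a c = 0 ->
  a \notin Z1 :|: Z2 -> c \notin Z1 :|: Z2 ->
  (forall j, j \in Z1 :|: Z2 -> S c j = g * S a j) ->
  explained a Z1 <= explained a Z2 -> pcorr2 S a c Z1 <= pcorr2 S a c Z2.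
Proof.
move=> ac0 aZ cZ cga le12.
have pE Z : Z \subset Z1 :|: Z2 ->
    [/\ pcorr2 S a c Z = g ^+ 2 * explained a Z ^+ 2 /
      ((S a a - explained a Z) * (S c c - g ^+ 2 * explained a Z)),
    0 < S a a - explained a Z & 0 < S c c - g ^+ 2 * explained a Z].
  move=> /fintype.subsetP ZZ.
  have [|pac pcc] := @pcov_proportional a c g Z; first by move=> j /ZZ; exact: cga.
  rewrite /pcorr2 pac -pcc subKr ac0 sub0r sqrrN exprMn; split=> //.
    by apply: pcov_gt0; apply: contra aZ; exact: ZZ.
  by apply: pcov_gt0; apply: contra cZ; exact: ZZ.
have [-> a1 c1] := pE _ (finset.subsetUl Z1 Z2).
have [-> a2 c2] := pE _ (finset.subsetUr Z1 Z2).
have g2 := sqr_ge0 g; have W0 := explained_ge0 a Z1.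
apply: ler_pM.
- by rewrite mulr_ge0// sqr_ge0.
- by rewrite invr_ge0 mulr_ge0// ltW.
- by rewrite ler_wpM2l// ler_sqr// nnegrE (le_trans W0).
- rewrite lef_pV2 ?posrE ?mulr_gt0//.
  apply: ler_pM; [exact: ltW|exact: ltW|exact: lerB|].
  by apply: lerB => //; exact: ler_wpM2l.
Qed.

(** The linear algebra content of the theorem, with each independence assumption replaced by the
    covariance identity it implies. *)
Lemma pcorr2_monotone (a c x z : 'I_n) B :
  a \notin z |: B -> c \notin z |: B ->
  S a c = 0 ->
  (forall u v, u \in [set a; c] -> v \in z |: B ->
     S u v * S x x = S u x * S x v) ->
  pcorr2 S a c B <= pcorr2 S a c (z |: B) /\
  (forall z', z' \notin [set a; c] ->
    (forall v, v \in [set a; c] :|: B -> S z' v * S z z = S z' z * S z v) ->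
    pcorr2 S a c B <= pcorr2 S a c (z' |: B) /\
    pcorr2 S a c (z' |: B) <= pcorr2 S a c (z |: B)).
Proof.
move=> aB cB ac0 hx.
have /lt0r_neq0 Sxx := posdef_diag_gt0 x.
have aE v : v \in z |: B -> S a v = S a x / S x x * S x v.
  by move=> vB; apply: (mulIf Sxx); rewrite hx// ?set21//; field.
have cE v : v \in z |: B -> S c v = S c x / S x x * S x v.
  by move=> vB; apply: (mulIf Sxx); rewrite hx// ?set22//; field.
have sub1 := finset.subsetUr [set z] B.
(* The factor relating S_uz' to S_uz is the same for u = a and u = c, so the ratio between c and a
   found at z persists at z'. *)
have z'E z' u : u \in [set a; c] -> 
    (forall v, v \in [set a; c] :|: B -> S z' v * S z z = S z' z * S z v) ->
    S u z' = S z' z / S z z * S u z.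
  move=> uac hz; apply: (mulIf (lt0r_neq0 (posdef_diag_gt0 z))).
  rewrite posdef_sym hz ?inE; last by move: uac; rewrite !inE => ->.
  rewrite (posdef_sym z u); field; exact/lt0r_neq0/posdef_diag_gt0.
have zB : z \in z |: B by rewrite setU11.
(* If S_ax = 0, then V_a is uncorrelated with all conditioning variables, z' included, and every
   squared partial correlation is 0. Otherwise g = S_cx / S_ax is available. *)
have [ax0|ax0] := eqVneq (S a x) 0.
  have a0 v : v \in z |: B -> S a v = 0 by move=> /aE ->; rewrite ax0 !mul0r.
  have p0 := pcorr2_uncorrelated ac0 a0.
  have pB0 : pcorr2 S a c B = 0.
    by apply: pcorr2_uncorrelated => // j jB; apply: a0; exact: setU1r.
  rewrite p0 pB0; split=> // z' _ hz'.
  rewrite pcorr2_uncorrelated// => j; rewrite in_setU1 => /predU1P[->|jB].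
    by rewrite (z'E z') ?set21// a0// mulr0.
  by apply: a0; exact: setU1r.
have cga v : v \in z |: B -> S c v = S c x / S a x * S a v.
  by move=> vB; rewrite (aE v vB) (cE v vB); field; rewrite Sxx.
split.
  apply: (pcorr2_le (g := S c x / S a x)); rewrite ?(finset.setUidPr sub1)//.
  exact: explained_subset.
move=> z' z'ac hz'.
have cgaz' v : v \in z' |: (z |: B) -> S c v = S c x / S a x * S a v.
  rewrite in_setU1 => /predU1P[->|/cga//].
  rewrite (z'E _ _ (set22 a c) hz') (z'E _ _ (set21 a c) hz') (cga z zB).
  by rewrite mulrCA.
have az' : a \notin z' |: (z |: B).
  by rewrite in_setU1 negb_or aB andbT; apply: contraNneq z'ac => <-; exact: set21.
have cz' : c \notin z' |: (z |: B).
  by rewrite in_setU1 negb_or cB andbT; apply: contraNneq z'ac => <-; exact: set22.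
split; apply: (pcorr2_le (g := S c x / S a x)) => //.
- by apply: contra az'; rewrite !inE => /or3P[->|->|->]; rewrite ?orbT.
- by apply: contra cz'; rewrite !inE => /or3P[->|->|->]; rewrite ?orbT.
- move=> v vB; apply: cgaz'; move: vB.
  by rewrite !inE => /or3P[->|->|->]; rewrite ?orbT.
- exact/explained_subset/finset.subsetUr.
- by apply: contra az'; rewrite !inE => /orP[] /orP[] ->; rewrite ?orbT.
- by apply: contra cz'; rewrite !inE => /orP[] /orP[] ->; rewrite ?orbT.
- move=> v vB; apply: cgaz'; move: vB.
  by rewrite !inE => /orP[] /orP[] ->; rewrite ?orbT.
- apply: explained_degraded => j jB; apply: hz'.
  by move: jB; rewrite !inE => /orP[] ->; rewrite ?orbT.
Qed.

End Covariance.

(** * Orthogonality of random variables *)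

Section Orthogonality.
Local Open Scope classical_set_scope.

Context d (T : measurableType d) (R : realType) (P : probability T R).
Implicit Types (f g h k : T -> R).

Import HBNNSimple.

(** The hypothesis says E[k | h] = 0. On each level set of s(h) the integral of k vanishes, and s(h)
    takes finitely many values. *)
Lemma integral_comp_nnsfun_eq0 (h k : T -> R) (s : {nnsfun R >-> R}) :
  measurable_fun setT h -> P.-integrable setT (EFin \o k) ->
  (forall C : set R, measurable C -> \int[P]_(w in h @^-1` C) (k w)%:E = 0)%E ->
  (\int[P]_w (s (h w) * k w)%:E = 0)%E.
Proof.
move=> mh ik hk.
pose r_ := finmap.enum_fset (fset_set (range s)).
have mC r : measurable (h @^-1` (s @^-1` [set r])).
  by rewrite -[X in measurable X]setTI; exact: mh.
have sE w : ((s (h w) * k w)%:E =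
   \sum_(r <- r_) (r%:E * ((EFin \o k) \_ (h @^-1` (s @^-1` [set r]))) w))%E.
  rewrite (fimfunE s) fsbig_finite//= mulr_suml -sumEFin.
  apply: eq_bigr => r _; rewrite EFinM EFinM -muleA; congr (_ * _)%E.
  rewrite patchE indicE.
  have -> : (h w \in s @^-1` [set r]) = (w \in h @^-1` (s @^-1` [set r])).
    by apply/idP/idP; rewrite !inE.
  by case: ifPn => _; rewrite ?mul1e ?mul0e.
rewrite (eq_integral (fun w => \sum_(r <- r_)
  (r%:E * ((EFin \o k) \_ (h @^-1` (s @^-1` [set r]))) w))%E); last first.
  by move=> w _; rewrite sE.
have ir r : P.-integrable setT ((EFin \o k) \_ (h @^-1` (s @^-1` [set r]))).
  by apply/(integrable_mkcond _ (mC r)); exact: integrableS ik.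
rewrite integral_sum//; last by move=> r; exact: integrableZl.
by rewrite big1// => r _; rewrite integralZl// -integral_mkcond hk ?mule0.
Qed.

(** Approximate h from below by simple functions of h; dominated convergence applies with bound |h
    k|. *)
Lemma integral_ge0_orth (h k : T -> R) : (forall w, 0 <= h w) ->
  measurable_fun setT h -> P.-integrable setT (EFin \o k) ->
  P.-integrable setT (EFin \o (h \* k)) ->
  (forall C : set R, measurable C -> \int[P]_(w in h @^-1` C) (k w)%:E = 0)%E ->
  (\int[P]_w (h w * k w)%:E = 0)%E.
Proof.
move=> h0 mh ik ihk hk.
(* Approximation by nonnegative simple functions needs a function that is nonnegative on the whole
   line; truncation at 0 changes nothing on the values of h. *)
pose f (y : R) := (Num.max y 0)%:E.
have mf : measurable_fun [set: R] f.
  by apply/measurable_EFinP; exact: measurable_maxr.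
have f0 y : [set: R] y -> (0 <= f y)%E by rewrite lee_fin le_max lexx orbT.
pose s := nnsfun_approx measurableT mf.
have fh w : f (h w) = (h w)%:E by rewrite /f; congr EFin; apply/max_idPl.
have sh n w : s n (h w) <= h w.
  by rewrite -lee_fin -fh /s nnsfun_approxE; exact: le_approx.
have mk := measurable_int _ ik.
have msk n : measurable_fun setT (fun w => (s n (h w) * k w)%:E).
  apply/measurable_EFinP/measurable_funM; last exact/measurable_EFinP.
  exact: measurableT_comp mh.
have [] := @dominated_convergence _ _ _ P setT measurableT
  (fun n w => (s n (h w) * k w)%:E) (fun w => (h w * k w)%:E)
  (fun w => `|(h w * k w)%:E|%E) msk.
- exact: measurable_int ihk.
- apply: aeW => w _; apply: cvg_EFin; first exact: nearW.
  have shw : (s n (h w))%:E @[n --> \oo] --> (h w)%:E.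
    by rewrite -fh; exact: cvg_nnsfun_approx.
  by apply: cvgMl; move/fine_cvgP : shw => [].
- exact: integrable_abse.
- apply: aeW => w n _; rewrite lee_fin !normrM ler_wpM2r//.
  by rewrite !ger0_norm.
move=> _ _; rewrite [X in X @ _ --> _](_ : _ = cst 0%E).
  by move=> /cvg_lim <-//; rewrite lim_cst.
by apply/funext => n /=; exact: integral_comp_nnsfun_eq0.
Qed.

(** The positive and negative parts of h are functions of h bounded by |h|, so the nonnegative case
    applies to each. *)
Lemma integral_orth (h k : T -> R) :
  measurable_fun setT h -> P.-integrable setT (EFin \o k) ->
  P.-integrable setT (EFin \o (h \* k)) ->
  (forall C : set R, measurable C -> \int[P]_(w in h @^-1` C) (k w)%:E = 0)%E ->
  (\int[P]_w (h w * k w)%:E = 0)%E.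
Proof.
move=> mh ik ihk hk.
have part (phi : R -> R) : measurable_fun setT phi -> (forall y, 0 <= phi y) ->
    (forall y, phi y <= `|y|) ->
    P.-integrable setT (EFin \o ((phi \o h) \* k)) /\
    (\int[P]_w (phi (h w) * k w)%:E = 0)%E.
  move=> mphi phi0 phile.
  have mph : measurable_fun setT (phi \o h) by exact: measurableT_comp.
  have ip : P.-integrable setT (EFin \o ((phi \o h) \* k)).
    apply: le_integrable ihk => //.
      apply/measurable_EFinP/measurable_funM => //.
      exact/measurable_EFinP/(measurable_int P).
    move=> w _ /=; rewrite lee_fin !normrM ler_wpM2r//.
    by rewrite ger0_norm.
  split=> //; apply: (integral_ge0_orth (h := phi \o h)) => // [w|C mC].
    exact: phi0.
  rewrite comp_preimage hk//.
  by rewrite -[X in measurable X]setTI; exact: mphi.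
have [ip p0] : P.-integrable setT (EFin \o ((fun w => Num.max (h w) 0) \* k)) /\
    (\int[P]_w (Num.max (h w) 0 * k w)%:E = 0)%E.
  apply: (part (fun y => Num.max y 0)).
  - exact: measurable_maxr.
  - by move=> y; rewrite le_max lexx orbT.
  - by move=> y; rewrite ge_max ler_norm normr_ge0.
have [iq q0] : P.-integrable setT (EFin \o ((fun w => Num.max (- h w) 0) \* k)) /\
    (\int[P]_w (Num.max (- h w) 0 * k w)%:E = 0)%E.
  apply: (part (fun y => Num.max (- y) 0)).
  - exact: measurable_maxr.
  - by move=> y; rewrite le_max lexx orbT.
  - by move=> y; rewrite ge_max -normrN ler_norm normr_ge0.
rewrite (eq_integral (fun w => (Num.max (h w) 0 * k w)%:E -
                               (Num.max (- h w) 0 * k w)%:E))%E; last first.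
  move=> w _; rewrite -EFinB -mulrBl; congr (_ * _)%:E.
  by rewrite /Order.max; case: ltP => ?; case: ltP => ?; lra.
by rewrite integralB_EFin// p0 q0 sube0.
Qed.

End Orthogonality.

(** * Expectations depend only on the law *)

Section EqualLaws.
Local Open Scope classical_set_scope.

Context d1 (T1 : measurableType d1) d2 (T2 : measurableType d2) (R : realType).
Variables (m1 : {measure set T1 -> \bar R}) (m2 : {measure set T2 -> \bar R}).
Variables (X : T1 -> R) (Y : T2 -> R).
Hypotheses (mX : measurable_fun setT X) (mY : measurable_fun setT Y).
Hypothesis XY : forall C : set R, measurable C -> m1 (X @^-1` C) = m2 (Y @^-1` C).

Let X' : {mfun T1 >-> R} := HB.pack X (isMeasurableFun.Build _ _ _ _ _ mX).
Let Y' : {mfun T2 >-> R} := HB.pack Y (isMeasurableFun.Build _ _ _ _ _ mY).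

Lemma ge0_integral_eq_law (f : R -> \bar R) :
  measurable_fun setT f -> (forall y, 0 <= f y)%E ->
  (\int[m1]_w f (X w) = \int[m2]_w f (Y w))%E.
Proof.
move=> mf f0.
transitivity (\int[pushforward m1 X']_y f y)%E.
  rewrite (ge0_integral_pushforward mX) //.
transitivity (\int[pushforward m2 Y']_y f y)%E.
  by apply: eq_measure_integral => A mA _; exact: XY.
by rewrite (ge0_integral_pushforward mY).
Qed.

Lemma integrable_eq_law : m2.-integrable setT (EFin \o Y) ->
  m1.-integrable setT (EFin \o X).
Proof.
move=> /integrableP[mY' iY]; apply/integrableP; split; first exact/measurable_EFinP.
have mn : measurable_fun [set: R] (fun y : R => `|y|%:E).
  by apply/measurable_EFinP; exact: normr_measurable.
by rewrite (ge0_integral_eq_law (f := fun y : R => `|y|%:E)).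
Qed.

Lemma integral_eq_law : m1.-integrable setT (EFin \o X) ->
  m2.-integrable setT (EFin \o Y) -> 
  (\int[m1]_w (X w)%:E = \int[m2]_w (Y w)%:E)%E.
Proof.
move=> iX iY.
have mE : measurable_fun [set: R] (EFin : R -> \bar R) by exact/measurable_EFinP.
transitivity (\int[pushforward m1 X']_y (y%:E))%E.
  by rewrite (integral_pushforward mX mE iX).
transitivity (\int[pushforward m2 Y']_y (y%:E))%E.
  by apply: eq_measure_integral => A mA _; exact: XY.
by rewrite (integral_pushforward mY mE iY).
Qed.

End EqualLaws.

(** * Conditional mean zero from the symmetry of W + sZ in s *)

Section Symmetry.
Local Open Scope classical_set_scope.

Context d (T : measurableType d) (R : realType) (P : probability T R).
Variables W Z : T -> R.
Hypotheses (iW : P.-integrable setT (EFin \o W))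
  (iZ : P.-integrable setT (EFin \o Z)).
Hypothesis WZ : forall (s : R) (C : set R), measurable C ->
  P ((fun w => W w + s * Z w) @^-1` C) = P ((fun w => W w + - s * Z w) @^-1` C).
Hypothesis W0 : forall c : R, P (W @^-1` [set c]) = 0%E.

Let mW : measurable_fun setT W. Proof. exact/measurable_EFinP/(measurable_int P). Qed.

Let iWZ s : P.-integrable setT (EFin \o (fun w => W w + s * Z w)).
Proof.
apply: (@eq_integrable _ _ _ _ _ measurableT
  (fun w => (W w)%:E + s%:E * (Z w)%:E)%E) => //.
by apply: integrableD => //; exact: integrableZl.
Qed.

Let mWZ s : measurable_fun setT (fun w => W w + s * Z w).
Proof. exact/measurable_EFinP/(measurable_int P)/iWZ. Qed.

Let integral_WZ s :
  (\int[P]_w (W w + s * Z w)%:E =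
   \int[P]_w (W w)%:E + s%:E * \int[P]_w (Z w)%:E)%E.
Proof.
by rewrite -integralZl// -integralD//; exact: integrableZl.
Qed.

(** Equal laws give E[W + Z] = E[W - Z]. *)
Let integral_Z : (\int[P]_w (Z w)%:E = 0)%E.
Proof.
have := integral_eq_law (mWZ 1) (mWZ (- 1)) (WZ 1) (iWZ 1) (iWZ (- 1)).
rewrite !integral_WZ.
move: (integrable_fin_num measurableT iW) (integrable_fin_num measurableT iZ).
move=> /fineK <- /fineK <-; rewrite -!EFinM -!EFinD => -[] ?; congr EFin; lra.
Qed.

Let mgt c : measurable (W @^-1` `]c, +oo[).
Proof. by rewrite -[X in measurable X]setTI; exact: mW. Qed.

(* Differentiate [E (W + s Z - c)^+], an even function of [s], at [s = 0]. *)
Let integral_gt c : (\int[P]_(w in W @^-1` `]c, +oo[) (Z w)%:E = 0)%E.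
Proof.
pose phi (y : R) := Num.max (y - c) 0.
have mphi : measurable_fun setT phi.
  by apply: measurable_maxr => //; exact: measurable_funB.
have phi_lip x y : `|phi x - phi y| <= `|x - y|.
  have := ler_norm (x - y); have := ler_norm (- (x - y)); rewrite normrN.
  rewrite /phi /Order.max.
  by case: ltP => ?; case: ltP => ?; rewrite !ler_norml; lra.
pose t n : R := n.+1%:R^-1.
(* The symmetric difference quotient at 0 of s |-> phi(W + sZ) with step [t n]; the factor is 1 / (2
   [t n]). *)
pose q n w := n.+1%:R / 2 * (phi (W w + t n * Z w) - phi (W w + - t n * Z w)).
have mpWZ s : measurable_fun setT (fun w => phi (W w + s * Z w)).
  exact: (measurableT_comp mphi).
have mq n : measurable_fun setT (EFin \o q n).
  by apply/measurable_EFinP/measurable_funM => //; exact: measurable_funB.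
have ipWZ s : P.-integrable setT (EFin \o (fun w => phi (W w + s * Z w))).
  apply: (@le_integrable _ _ _ _ _ measurableT _
    (EFin \o (fun w => `|W w + s * Z w| + `|c|))).
  - exact/measurable_EFinP.
  - move=> w _ /=; rewrite lee_fin.
    have := phi_lip (W w + s * Z w) c.
    rewrite {2}/phi subrr maxxx subr0 => /le_trans -> //.
    by rewrite [leRHS]ger0_norm ?addr_ge0// ler_normB.
  - apply: (@eq_integrable _ _ _ _ _ measurableT
      (fun w => (`|W w + s * Z w|%R)%:E + (`|c|%R)%:E)%E) => //.
    apply: integrableD => //; first exact: integrable_norm.
    exact: finite_measure_integrable_cst.
have iB n : P.-integrable setT
    (fun w => (phi (W w + t n * Z w))%:E - (phi (W w + - t n * Z w))%:E)%E.
  exact: (integrableB measurableT (ipWZ (t n)) (ipWZ (- t n))).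
have Iq n : (\int[P]_w (EFin \o q n) w = 0)%E.
  rewrite /q.
  under eq_integral do rewrite /= EFinM EFinB.
  rewrite (integralZl measurableT (iB n)).
  rewrite integralB_EFin// (ge0_integral_eq_law (mWZ (t n)) (mWZ (- t n)) (WZ (t n))
    (f := EFin \o phi)) /=.
  - have fn := integrable_fin_num measurableT (ipWZ (- t n)).
    by rewrite subee ?mule0.
  - exact/measurable_EFinP.
  - by move=> y; rewrite lee_fin le_max lexx orbT.
have [] := @dominated_convergence _ _ _ P setT measurableT
  (fun n => EFin \o q n) ((EFin \o Z) \_ (W @^-1` `]c, +oo[))
  (fun w => `|(Z w)%:E|%E) mq.
- apply/(measurable_restrictT _ (mgt c))/measurable_funTS.
  exact: (measurable_int P).
(* Pointwise convergence can fail only at the kink W = c of [phi], a null event. Elsewhere W + tZ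
   and W - tZ are eventually on the same side of c, and the quotient is constantly Z or 0. *)
- exists (W @^-1` [set c]); split.
  + by rewrite -[X in measurable X]setTI; exact: mW.
  + exact: W0.
  + move=> w /= /not_implyP[_]; apply: contra_notP => Wc.
    have t0 : (t n * Z w) @[n --> \oo] --> (0 : R).
      rewrite -[X in _ --> X](mul0r (Z w)); apply: cvgMl.
      exact: cvg_harmonic.
    have [cW|Wlec] := ltP c (W w).
      have d0 : 0 < W w - c by rewrite subr_gt0.
      rewrite patchE mem_set /=; last by rewrite in_itv/= cW.
      apply: cvg_near_cst.
      move/cvgrPdist_lt : t0 => /(_ _ d0); apply: filterS => n.
      rewrite sub0r normrN => tZ; congr EFin.
      rewrite /q /phi /Order.max !ifF; last 2 first.
      * by apply/negbTE; rewrite -leNgt; move: tZ; rewrite ltr_norml => /andP[]; lra.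
      * by apply/negbTE; rewrite -leNgt; move: tZ; rewrite ltr_norml => /andP[]; lra.
      rewrite (_ : _ - _ = 2 * (t n * Z w)); last by ring.
      by rewrite /t; field; rewrite nat1r pnatr_eq0.
    have d0 : 0 < c - W w by rewrite subr_gt0 lt_neqAle Wlec andbT; apply/eqP.
    rewrite patchE memNset /=; last by rewrite in_itv/= ltNge Wlec.
    apply: cvg_near_cst.
    move/cvgrPdist_lt : t0 => /(_ _ d0); apply: filterS => n.
    rewrite sub0r normrN => tZ; congr EFin.
    rewrite /q /phi /Order.max !ifT ?subrr ?mulr0//.
    * by move: tZ; rewrite ltr_norml => /andP[]; lra.
    * by move: tZ; rewrite ltr_norml => /andP[]; lra.
- exact: integrable_abse.
(* Since [phi] is 1-Lipschitz, the quotient is at most |Z|. *)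
- apply: aeW => w n _; rewrite lee_fin /q normrM ger0_norm ?divr_ge0//.
  apply: (@le_trans _ _ (n.+1%:R / 2 * `|2 * (t n * Z w)|)).
    rewrite ler_wpM2l ?divr_ge0//; apply: (le_trans (phi_lip _ _)).
    by rewrite le_eqVlt; apply/orP; left; apply/eqP; congr (`|_|); ring.
  rewrite !normrM (ger0_norm (_ : 0 <= 2))// ger0_norm ?invr_ge0//.
  rewrite le_eqVlt; apply/orP; left; apply/eqP; rewrite /t.
  by field; rewrite nat1r pnatr_eq0.
move=> _ _; rewrite [X in X @ _ --> _](_ : _ = cst 0%E).
  by rewrite -integral_mkcond => /cvg_lim <-//; rewrite lim_cst.
by apply/funext => n /=; exact: Iq.
Qed.

(** The open half-lines treated in [integral_gt] form a generating pi-system, and the sets C with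
    the property form a Dynkin class; complements use E[Z] = 0. *)
Lemma integral_preimage_symmetric (C : set R) : measurable C ->
  (\int[P]_(w in W @^-1` C) (Z w)%:E = 0)%E.
Proof.
move=> mC.
pose Q (C : set R) := (\int[P]_(w in W @^-1` C) (Z w)%:E = 0)%E.
have mWC A : measurable A -> measurable (W @^-1` A).
  by move=> mA; rewrite -[X in measurable X]setTI; exact: mW.
apply: (@dynkin_induction _ (measurableTypeR R) (@RGenOInfty.G R) Q) => //.
- exact: RGenOInfty.measurableE.
- move=> _ _ [x ->] [y ->]; exists (Num.max x y).
  apply/seteqP; split => z /=; rewrite !in_itv/= !andbT gt_max; first by move=> [-> ->].
  by move=> /andP[].
- by move=> _ [x ->]; exact: integral_gt.
- move=> A mA QA; rewrite /Q preimage_setC.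
  have := integral_Z; rewrite -(setUv (W @^-1` A)) integral_setU.
  + by rewrite QA add0e.
  + exact: mWC.
  + exact/measurableC/mWC.
  + by rewrite setUv; exact: measurable_int iZ.
  + by rewrite disj_set2E setICr.
- move=> F mF tF QF; rewrite /Q preimage_bigcup integral_bigcup.
  + rewrite (eq_eseriesr (g := fun=> 0%E)) ?eseries0// => i _; exact: QF.
  + by move=> i j _ _ [w [/= Fi Fj]]; apply: (tF i j) => //; exists (W w).
  + by move=> k; apply: mWC; exact: mF.
  + apply: integrableS iZ => //; apply: bigcup_measurable => k _.
    by apply: mWC; exact: mF.
- have E : @measurable _ (measurableTypeR R) = <<s @RGenOInfty.G R >>.
    exact: RGenOInfty.measurableE.
  by rewrite -E.
Qed.

End Symmetry.

(** * The normal distribution *)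

Section Normal.
Local Open Scope classical_set_scope.

Context (R : realType).
Local Notation mu := (@lebesgue_measure R).

Lemma lebesgue_measure_translation (m : R) (A : set R) : measurable A ->
  pushforward mu ((fun y : R => y + m) : R -> measurableTypeR R) A = mu A.
Proof.
move=> mA.
have mt : measurable_fun setT ((fun y : R => y + m) : R -> measurableTypeR R).
  exact: measurable_funD.
apply/esym/lebesgue_measure_unique => //= _ [[a b]] _ <-.
rewrite /pushforward (_ : _ @^-1` _ = `]a - m, b - m]%classic); last first.
  by apply/seteqP; split=> y /=; rewrite !in_itv/= ltrBlDr lerBrDr.
by rewrite !lebesgue_measure_itv/= !lte_fin ltrD2r -!EFinB opprB addrA addrNK.
Qed.

(** Translation invariance of Lebesgue measure. Centering lets laws of combinations with different
    means be compared through their variances. *)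
Lemma normal_prob_center (m s : R) (C : set R) : s != 0 -> measurable C ->
  normal_prob m s C = normal_prob 0 s ((fun y => y + m) @^-1` C).
Proof.
move=> s0 mC; rewrite /normal_prob.
pose t : measurableTypeR R -> measurableTypeR R := fun y : R => y + m.
have mt : measurable_fun setT t by exact: measurable_funD.
transitivity (\int[pushforward mu t]_(x in C) (normal_pdf m s x)%:E)%E.
  apply: eq_measure_integral => A mA _; apply/esym.
  exact: lebesgue_measure_translation.
rewrite (ge0_integral_pushforward mt)//.
- apply: eq_integral => y _ /=; rewrite !normal_pdfE//.
  by rewrite /normal_fun subr0 addrK.
- apply/measurable_EFinP/measurable_funTS; exact: measurable_normal_pdf.
- by move=> y _; rewrite lee_fin normal_pdf_ge0.
Qed.

(** The Radon-Nikodym derivative and the density have the same integral over every measurable set,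
    so they agree almost everywhere. *)
Lemma ge0_integral_normal_prob (m s : R) (f : R -> \bar R) : 
  measurable_fun setT f -> (forall y, 0 <= f y)%E ->
  (\int[normal_prob m s]_y f y = \int[mu]_y (f y * (normal_pdf m s y)%:E))%E.
Proof.
move=> mf f0.
rewrite -(Radon_Nikodym_SigmaFinite.change_of_variables (mu := mu))//; last first.
  exact: normal_prob_dominates.
apply: ae_eq_integral => //.
- apply: emeasurable_funM => //.
  exact: measurable_int (Radon_Nikodym_SigmaFinite.f_integrable
    (normal_prob_dominates _ _)).
- apply: emeasurable_funM => //; apply/measurable_EFinP; exact: measurable_normal_pdf.
- apply: ae_eqe_mul2l; apply: integral_ae_eq => //.
  + exact: (Radon_Nikodym_SigmaFinite.f_integrable (normal_prob_dominates _ _)).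
  + apply/measurable_EFinP; exact: measurable_normal_pdf.
  + move=> A _ mA; rewrite -Radon_Nikodym_SigmaFinite.f_integral//.
    exact: normal_prob_dominates.
Qed.

Lemma normal_prob_integrable_id (m s : R) : s != 0 ->
  (normal_prob m s).-integrable setT (EFin \o (@idfun R)).
Proof.
move=> s0; apply/integrableP; split.
  by apply/measurable_EFinP; exact: measurable_id.
rewrite ge0_integral_normal_prob//; last first.
  by apply/measurable_EFinP; exact: normr_measurable.
(* Doubling the variance: with x = (y - m)^2 / (4 s^2), the density decays like exp(-x) exp(-x). One
   factor absorbs |y - m|; the other is the shape of N(m, 2 s^2). *)
pose s' := Num.sqrt 2 * s.
have s'0 : s' != 0 by rewrite mulf_neq0// gt_eqF// sqrtr_gt0.
(* The constant comes from |y - m| <= 1 + 4 s^2 x <= (1 + 4 s^2) exp(x), together with the ratio of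
   the two peaks. *)
pose K := normal_peak s * (1 + s ^+ 2 *+ 4) / normal_peak s'.
pose g y := `|m| * normal_pdf m s y + K * normal_pdf m s' y.
apply: (@le_lt_trans _ _ (\int[mu]_y (g y)%:E)%E); last first.
  apply: integrable_lty => //.
  have i1 := @integrableZl _ _ R mu _ measurableT `|m| _ (integrable_normal_pdf m s).
  have i2 := @integrableZl _ _ R mu _ measurableT K _ (integrable_normal_pdf m s').
  exact: (integrableD measurableT i1 i2).
apply: ge0_le_integral => //.
- by move=> y _; rewrite mule_ge0// lee_fin normal_pdf_ge0.
- apply/measurable_EFinP/measurable_funM; last exact: measurable_normal_pdf.
  exact: normr_measurable.
- apply/measurable_EFinP/measurable_funD; apply/measurable_funM => //;
  exact: measurable_normal_pdf.
move=> y _; rewrite lee_fin /= /g.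
have ym : `|y| <= `|m| + `|y - m| by rewrite -{1}(subrK m y) addrC ler_normD.
apply: le_trans (ler_wpM2r (normal_pdf_ge0 m s y) ym) _; rewrite mulrDl lerD2l.
rewrite !normal_pdfE// /K -!mulrA mulKf; last by rewrite gt_eqF// normal_peak_gt0.
rewrite mulrCA ler_wpM2l ?normal_peak_ge0// /normal_fun.
pose x := (y - m) ^+ 2 / (s ^+ 2 *+ 4).
have s2 : s ^+ 2 != 0 by rewrite sqrf_eq0.
have -> : - (y - m) ^+ 2 / (s ^+ 2 *+ 2) = - x - x by rewrite /x; field.
have -> : - (y - m) ^+ 2 / (s' ^+ 2 *+ 2) = - x.
  by rewrite /x /s' exprMn sqr_sqrtr//; field.
have x0 : 0 <= x by rewrite divr_ge0 ?sqr_ge0// mulrn_wge0 ?sqr_ge0.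
have ymx : `|y - m| <= 1 + s ^+ 2 *+ 4 * x.
  have -> : s ^+ 2 *+ 4 * x = `|y - m| ^+ 2.
    by rewrite real_normK ?num_real// /x; field.
  have := sqr_ge0 (`|y - m| - 1); have := normr_ge0 (y - m); nra.
rewrite expRD mulrA ler_wpM2r ?expR_ge0//.
have e1 : 1 + x <= expR x by exact: expR_ge1Dx.
rewrite expRN ler_pdivrMr ?expR_gt0//; apply: (le_trans ymx).
have := sqr_ge0 s; nra.
Qed.

End Normal.

(** * Conditional probabilities *)

Section Centered.
Local Open Scope classical_set_scope.

Context d (T : measurableType d) (R : realType) (P : probability T R).
Implicit Types (f g h k : T -> R) (D : set T).

(** Carrying integrability along with E[f] = 0 makes these identities closed under linear
    combinations, so they can be added like equations. *)
Definition centered f : Prop :=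
  P.-integrable setT (EFin \o f) /\ (\int[P]_w (f w)%:E = 0)%E.

Lemma eq_centered f g : f =1 g -> centered f -> centered g.
Proof. by move=> /funext ->. Qed.

Lemma centeredD f g : centered f -> centered g -> centered (fun w => f w + g w).
Proof.
move=> [fi f0] [gi g0]; split; first exact: (integrableD measurableT fi gi).
by rewrite (integralD measurableT fi gi) f0 g0 add0e.
Qed.

Lemma centeredZ (c : R) f : centered f -> centered (fun w => c * f w).
Proof.
move=> [fi f0]; split; first exact: (integrableZl measurableT c fi).
by rewrite (integralZl measurableT fi) f0 mule0.
Qed.

Lemma centeredB f g : centered f -> centered g -> centered (fun w => f w - g w).
Proof.
move=> cf /(centeredZ (- 1)) /(centeredD cf); apply: eq_centered => w.
by rewrite mulN1r.
Qed.

Lemma integrable_measurable f :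
  P.-integrable setT (EFin \o f) -> measurable_fun setT f.
Proof. by move=> /measurable_int/measurable_EFinP. Qed.

Lemma integrable_mul_indic f D : measurable D -> P.-integrable setT (EFin \o f) ->
  P.-integrable setT (EFin \o (fun w => \1_D w * f w)).
Proof.
move=> mD fi; apply: (le_integrable measurableT _ _ fi).
  apply/measurable_EFinP/measurable_funM; first exact: measurable_indic.
  exact: integrable_measurable.
move=> w _ /=; rewrite lee_fin normrM indicE; case: (w \in D).
  by rewrite normr1 mul1r.
by rewrite normr0 mul0r.
Qed.

Lemma integral_mul_indic f D :
  (\int[P]_w (\1_D w * f w)%:E = \int[P]_(w in D) (f w)%:E)%E.
Proof.
rewrite [RHS]integral_mkcond; apply: eq_integral => w _; rewrite patchE indicE.
by case: ifPn => _; rewrite ?mul1r ?mul0r.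
Qed.

Lemma centered_indic f D : measurable D -> P.-integrable setT (EFin \o f) ->
  (\int[P]_(w in D) (f w)%:E = 0)%E <-> centered (fun w => \1_D w * f w).
Proof.
move=> mD fi; rewrite /centered integral_mul_indic.
split=> [I0|[]//]; split; last exact: I0.
exact: integrable_mul_indic.
Qed.

Lemma centered_orth (h k : T -> R) :
  measurable_fun setT h -> P.-integrable setT (EFin \o k) ->
  P.-integrable setT (EFin \o (fun w => h w * k w)) ->
  (forall C : set R, measurable C -> centered (fun w => \1_(h @^-1` C) w * k w)) ->
  centered (fun w => h w * k w).
Proof.
move=> mh ik ihk hk; split=> //; apply: integral_orth => // C mC.
apply/(centered_indic _ ik); last exact: hk.
by rewrite -[X in measurable X]setTI; exact: mh.
Qed.

Lemma integrable_ae_bounded_mul (h k : T -> R) : measurable_fun setT h ->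
  {ae P, forall w, 0 <= h w <= 1} -> P.-integrable setT (EFin \o k) ->
  P.-integrable setT (EFin \o (fun w => h w * k w)).
Proof.
move=> mh h01 ik; have mk := integrable_measurable ik.
have mhk : measurable_fun setT (fun w => h w * k w) by exact: measurable_funM.
apply/integrableP; split; first exact/measurable_EFinP.
move/integrableP : ik => [_]; apply: le_lt_trans; apply: ae_ge0_le_integral => //.
- by apply/measurable_EFinP; exact: measurableT_comp.
- by apply/measurable_EFinP; exact: measurableT_comp.
- apply: filterS h01 => w /andP[h0 h1] _ /=.
  by rewrite lee_fin normrM ger0_norm// ler_piMl.
Qed.

Lemma ae_eq_centered f g : measurable_fun setT g ->
  {ae P, forall w, f w = g w} -> centered f -> centered g.
Proof.
move=> mg fg [fi f0]; have mf := integrable_measurable fi.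
have mf' := measurable_int _ fi.
have mg' : measurable_fun setT (EFin \o g) by exact/measurable_EFinP.
split; last first.
  by rewrite -f0; apply: ae_eq_integral => //; apply: filterS fg => w /= ->.
apply/integrableP; split=> //; move/integrableP : fi => [_].
rewrite [X in (X < _)%E -> _](_ : _ = \int[P]_w `|(EFin \o g) w|)%E//.
apply: ae_eq_integral => //; [exact: measurableT_comp|exact: measurableT_comp|].
by apply: filterS fg => w /= ->.
Qed.

Lemma integral_gt0_null f D : measurable D -> P.-integrable D (EFin \o f) ->
  (forall w, D w -> 0 < f w) -> (\int[P]_(w in D) (f w)%:E <= 0)%E -> P D = 0%E.
Proof.
move=> mD fi f0 If.
have : (\int[P]_(w in D) `|(f w)%:E| = 0)%E.
  apply/eqP; rewrite eq_le integral_ge0// andbT.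
  rewrite (eq_integral (fun w => (f w)%:E))// => w; rewrite inE => /f0 fw.
  by rewrite gee0_abs// lee_fin ltW.
move/(ae_eq_integral_abs P mD (measurable_int _ fi)) => aef.
apply/negligibleP => //; apply: negligibleS aef => w Dw /=.
by move=> /(_ Dw) /= [] /eqP; rewrite gt_eqF// f0.
Qed.

Variables (G : set (set T)).
Hypothesis mG : forall D, G D -> measurable D.

Lemma cond_prob_measurable A f : is_cond_prob P G A f -> measurable_fun setT f.
Proof. by case=> _ /integrable_measurable. Qed.

(** The events f < 0 and f > 1 belong to G; the integral of f over an event D of G is P(A [&] D),
    which lies between 0 and P(D), so both events are null. *)
Lemma cond_prob_bounded A f : measurable A -> is_cond_prob P G A f ->
  {ae P, forall w, 0 <= f w <= 1}.
Proof.
move=> mA [Gf fi fP].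
have fiD D : measurable D -> P.-integrable D (EFin \o f).
  by move=> mD; exact: integrableS fi.
have Gl : G (f @^-1` `]-oo, 0[) by apply: Gf; exact: measurable_itv.
have Gr : G (f @^-1` `]1, +oo[) by apply: Gf; exact: measurable_itv.
have l0 : P (f @^-1` `]-oo, 0[) = 0%E.
  apply: (@integral_gt0_null (fun w => - f w)); first exact: mG.
  - by have := integrableN (fiD _ (mG Gl)).
  - by move=> w /=; rewrite in_itv/= oppr_gt0.
  - under eq_integral do rewrite EFinN.
    rewrite integralN.
      by rewrite fP// leeNl oppe0.
    exact: (integrable_add_def (mG Gl) (fiD _ (mG Gl))).
have r0 : P (f @^-1` `]1, +oo[) = 0%E.
  have i1 := finite_measure_integrable_cst P 1 (mG Gr).
  apply: (@integral_gt0_null (fun w => f w - 1)); first exact: mG.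
  - exact: (integrableB (mG Gr) (fiD _ (mG Gr)) i1).
  - by move=> w /=; rewrite in_itv/= andbT subr_gt0.
  - rewrite integralB_EFin//; [|exact: mG|exact/fiD/mG].
    rewrite fP// integral_cst//; last exact: mG.
    rewrite mul1e sube_le0 le_measure ?inE//; [|exact: mG].
    by apply: measurableI => //; exact: mG.
exists (f @^-1` `]-oo, 0[ `|` f @^-1` `]1, +oo[); split.
- by apply: measurableU; exact: mG.
- by rewrite null_set_setU//; exact: mG.
- move=> w /= /negP; rewrite negb_and -!ltNge => /orP[f0|f1]; [left|right];
  by rewrite in_itv/= ?andbT.
Qed.

Lemma cond_prob_centered A f : measurable A -> is_cond_prob P G A f ->
  forall D, G D -> centered (fun w => \1_D w * (\1_A w - f w)).
Proof.
move=> mA [Gf fi fP] D GD; have mD := mG GD.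
have iA : P.-integrable setT (EFin \o (\1_A : T -> R)) by exact: integrable_indic.
apply/centered_indic => //; first exact: (integrableB measurableT iA fi).
rewrite integralB_EFin//; [|exact: integrableS iA|exact: integrableS fi].
rewrite fP// integral_indic// subee// fin_num_measure//; exact: measurableI.
Qed.

End Centered.

(** * Gaussian vectors *)

Section Gaussian.
Local Open Scope classical_set_scope.

Context d (T : measurableType d) (R : realType) (P : probability T R) (n : nat).
Variables (V : 'I_n -> {RV P >-> R}) (mu : 'rV[R]_n) (S : 'M[R]_n).
Hypotheses (gV : gaussian_vector V mu S) (Spd : posdefmx S).
Implicit Types (s t : 'rV[R]_n) (u v : 'I_n).

Local Notation e u := (delta_mx 0 u : 'rV[R]_n).

Definition combination t : T -> R := fun w => \sum_(i < n) t 0 i * V i w.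
Definition mean t : R := (mu *m t^T) 0 0.

Lemma combinationD s t w : combination (s + t) w = combination s w + combination t w.
Proof. by rewrite -big_split; apply: eq_bigr => i _; rewrite mxE mulrDl. Qed.

Lemma combinationZ (k : R) t w : combination (k *: t) w = k * combination t w.
Proof. by rewrite mulr_sumr; apply: eq_bigr => i _; rewrite mxE mulrA. Qed.

Lemma combination_delta u : combination (e u) = V u.
Proof.
apply/funext => w; rewrite /combination (bigD1 u)//= big1 => [|i /negbTE iu].
  by rewrite mxE !eqxx mul1r addr0.
by rewrite mxE iu andbF mul0r.
Qed.

Lemma meanD s t : mean (s + t) = mean s + mean t.
Proof. by rewrite /mean linearD mulmxDr mxE. Qed.

Lemma meanZ (k : R) t : mean (k *: t) = k * mean t.
Proof. by rewrite /mean linearZ -scalemxAr mxE. Qed.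

Lemma measurable_combination t : measurable_fun setT (combination t).
Proof. by apply: measurable_sum => i; exact: measurable_funM. Qed.

(** Positive definiteness excludes the degenerate branch of [normal_law] for t nonzero. *)
Lemma combination_law t (C : set R) : t != 0 -> measurable C ->
  P (combination t @^-1` C) = normal_prob (mean t) (Num.sqrt (cov S t t)) C.
Proof.
move=> t0 mC; have := gV t mC; rewrite /normal_law ifF; first exact.
by apply/negbTE; rewrite gt_eqF//; exact: cov_gt0.
Qed.

Lemma sd_neq0 t : t != 0 -> Num.sqrt (cov S t t) != 0.
Proof. by move=> t0; rewrite gt_eqF// sqrtr_gt0 cov_gt0. Qed.

Lemma combination_no_atom t (c : R) : t != 0 -> P (combination t @^-1` [set c]) = 0%E.
Proof.
move=> t0; rewrite combination_law//.
have /null_content_dominatesP dom :=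
  normal_prob_dominates (mean t) (Num.sqrt (cov S t t)).
by apply: dom => //; exact: lebesgue_measure_set1.
Qed.

Lemma integrable_combination t : P.-integrable setT (EFin \o combination t).
Proof.
have [->|t0] := eqVneq t 0.
  have -> : combination 0 = cst 0.
    by apply/funext => w; rewrite /combination big1// => i _; rewrite mxE mul0r.
  exact: finite_measure_integrable_cst.
apply: (integrable_eq_law (measurable_combination t) (@measurable_id _ _ setT)
  (m2 := normal_prob (mean t) (Num.sqrt (cov S t t)))).
  by move=> C mC; exact: combination_law.
exact/normal_prob_integrable_id/sd_neq0.
Qed.

Lemma centered_combination_law t (c : R) (C : set R) : t != 0 -> measurable C ->
  P ((fun w => combination t w - c) @^-1` C) =
  normal_prob 0 (Num.sqrt (cov S t t)) ((fun y => y + (mean t - c)) @^-1` C).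
Proof.
move=> t0 mC.
have mc : measurable_fun [set: R] (fun y => y - c) by exact: measurable_funB.
have mD : measurable ((fun y : R => y - c) @^-1` C).
  by rewrite -[X in measurable X]setTI; exact: mc.
rewrite (_ : _ @^-1` _ = combination t @^-1` ((fun y => y - c) @^-1` C))//.
rewrite (combination_law t0 mD) (normal_prob_center _ (sd_neq0 t0) mD).
by congr normal_prob; apply/funext => y /=; rewrite addrA.
Qed.

(** Without a cross term the variance of s.V + k t.V is even in k, so after centering the t part its
    law is even in k and the symmetry argument applies. *)
Lemma uncorrelated_centered s t : s != 0 -> cov S s t = 0 ->
  forall C : set R, measurable C ->
  centered P (fun w => \1_(combination s @^-1` C) w * (combination t w - mean t)).
Proof.
move=> s0 st0 C mC.
have it := integrable_combination t.
have iZ : P.-integrable setT (EFin \o (fun w => combination t w - mean t)).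
  have i1 := finite_measure_integrable_cst P (mean t) measurableT.
  exact: (integrableB measurableT it i1).
(* Its covariance with s is the variance of s.V, which is positive. *)
have st k : s + k *: t != 0.
  apply/eqP => sk0; have := cov_gt0 Spd s0.
  suff -> : cov S s s = 0 by rewrite ltxx.
  transitivity (cov S s (s + k *: t)); last by rewrite sk0 /cov trmx0 mulmx0 mxE.
  by rewrite (covDr Spd) (covZr Spd) st0 mulr0 addr0.
have vst k : cov S (s + k *: t) (s + k *: t) = cov S s s + k ^+ 2 * cov S t t.
  rewrite !(covDr Spd, covZr Spd, covDl, covZl) (covC Spd t s) st0; ring.
have sym k (D : set R) : measurable D ->
    P ((fun w => combination s w + k * (combination t w - mean t)) @^-1` D) =
    normal_prob 0 (Num.sqrt (cov S s s + k ^+ 2 * cov S t t))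
      ((fun y => y + mean s) @^-1` D).
  move=> mD; rewrite -vst.
  rewrite (_ : _ @^-1` _ = (fun w => combination (s + k *: t) w - k * mean t) @^-1` D).
    rewrite centered_combination_law//.
    by congr normal_prob; apply/funext => y /=; rewrite meanD meanZ addrK.
  by apply/seteqP; split=> w /=; rewrite combinationD combinationZ mulrBr addrA.
apply/(centered_indic _ iZ).
  by rewrite -[X in measurable X]setTI; exact: measurable_combination.
apply: (integral_preimage_symmetric (integrable_combination s) iZ) => //.
- by move=> k D mD; rewrite (sym k D mD) (sym (- k) D mD) sqrrN.
- by move=> c; exact: combination_no_atom.
Qed.

Lemma centered_uncorrelated s t (c : R) : s != 0 ->
  (forall C : set R, measurable C ->
    centered P (fun w => \1_(combination s @^-1` C) w * (combination t w - c))) ->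
  cov S s t = 0.
Proof.
move=> s0 hc; have vs := cov_gt0 Spd s0.
(* The regression coefficient of t.V on s.V; the residual [r] is uncorrelated with s. *)
pose b := cov S s t / cov S s s; pose r := t + (- b) *: s.
have sr : cov S s r = 0.
  by rewrite (covDr Spd) (covZr Spd) /b mulNr divfK ?subrr// gt_eqF.
(* What remains of t.V - c after subtracting the centered residual: an affine function of s.V with
   slope b. *)
pose l y := b * y + (mean r - c).
have hl C : measurable C ->
    centered P (fun w => \1_(combination s @^-1` C) w * l (combination s w)).
  move=> mC; have := centeredB (hc C mC) (uncorrelated_centered s0 sr mC).
  apply: eq_centered => w; rewrite /r combinationD combinationZ -mulrBr.
  by congr (_ * _); rewrite /l; ring.
apply/eqP; rewrite -[_ == _]negbK; apply/negP => st0.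
have b0 : b != 0 by rewrite mulf_neq0// invr_eq0 gt_eqF.
have ml : measurable_fun setT l.
  by apply: measurable_funD => //; exact: measurable_funM.
have il : P.-integrable setT (EFin \o (l \o combination s)).
  have := (hl setT measurableT).1; congr (P.-integrable setT).
  by apply/funext => w /=; rewrite preimage_setT indicT mul1r.
have mpre C : measurable C -> measurable (combination s @^-1` C).
  by move=> mC; rewrite -[X in measurable X]setTI; exact: measurable_combination.
have mlpre C : measurable C -> measurable (l @^-1` C).
  by move=> mC; rewrite -[X in measurable X]setTI; exact: ml.
have Il C : measurable C ->
    (\int[P]_(w in combination s @^-1` C) (l (combination s w))%:E = 0)%E.
  by move=> mC; apply/(centered_indic (mpre _ mC) il); exact: hl.
have mpos : measurable (l @^-1` `]0, +oo[) by apply: mlpre; exact: measurable_itv.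
have mneg : measurable (l @^-1` `]-oo, 0[) by apply: mlpre; exact: measurable_itv.
have p0 : P (combination s @^-1` (l @^-1` `]0, +oo[)) = 0%E.
  apply: (@integral_gt0_null _ _ _ _ (l \o combination s)); first exact: mpre.
  - by apply: integrableS il => //; exact: mpre.
  - by move=> w /=; rewrite in_itv/= andbT.
  - by rewrite Il.
have n0 : P (combination s @^-1` (l @^-1` `]-oo, 0[)) = 0%E.
  apply: (@integral_gt0_null _ _ _ _ (fun w => - l (combination s w))); first exact: mpre.
  - have := integrableN (integrableS measurableT (mpre _ mneg) (@subsetT _ _) il).
    exact.
  - by move=> w /=; rewrite in_itv/= oppr_gt0.
  - under eq_integral do rewrite EFinN.
    rewrite integralN ?Il ?oppe0//.
    apply: (integrable_add_def (mpre _ mneg)).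
    exact: (integrableS measurableT (mpre _ mneg) (@subsetT _ _) il).
(* For b nonzero, l vanishes at a single point, whose preimage is null. With the null events l > 0
   and l < 0 this exhausts the space, which has mass 1. *)
have z0 := combination_no_atom ((c - mean r) / b) s0.
have : P setT = 0%E.
  rewrite (_ : setT = combination s @^-1` (l @^-1` `]0, +oo[) `|`
    combination s @^-1` (l @^-1` `]-oo, 0[) `|`
    combination s @^-1` [set (c - mean r) / b]).
    have mp := mpre _ mpos; have mn := mpre _ mneg.
    have mz : measurable (combination s @^-1` [set (c - mean r) / b]).
      exact: mpre.
    by rewrite null_set_setU ?null_set_setU//; exact: measurableU.
  apply/esym/seteqP; split=> // w _ /=; rewrite !in_itv/= andbT.
  have [lt0|gt0|eq0] := ltgtP (l (combination s w)) 0;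
    [by left; right|by left; left|right].
  by move: eq0; rewrite /l => eq0; apply: (mulfI b0); rewrite mulrCA mulfV// mulr1; lra.
by rewrite probability_setT => /eqP; rewrite onee_eq0.
Qed.

(** * From independence of events to identities between covariances *)

Lemma measurable_sigma_of (I : {set 'I_n}) A : sigma_of V I A -> measurable A.
Proof.
move=> IA; apply: IA; split; first exact: sigma_algebra_measurable.
move=> D [i _ [C mC <-]]; exact: measurable_funP.
Qed.

Lemma sigma_of_preimage (I : {set 'I_n}) i (C : set R) : i \in I ->
  measurable C -> sigma_of V I (V i @^-1` C).
Proof.
move=> iI mC; apply: sub_sigma_algebra; exists i => //.
by exists C => //; rewrite setTI.
Qed.

Lemma sigma_of1 i A : sigma_of V [set i]%SET A ->
  exists2 C : set R, measurable C & A = V i @^-1` C.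
Proof.
have sA : sigma_algebra [set: T] (preimage_set_system setT (V i) (@measurable _ R)).
  by apply: sigma_algebra_preimage; exact: sigma_algebra_measurable.
move=> iA; have [C mC <-] : preimage_set_system setT (V i) (@measurable _ R) A.
  apply: iA; split => // D [j /=]; rewrite inE => /eqP ->; exact.
by exists C => //; rewrite setTI.
Qed.

Let iV u : P.-integrable setT (EFin \o V u).
Proof. by rewrite -combination_delta; exact: integrable_combination. Qed.

Let mV u (C : set R) : measurable C -> measurable (V u @^-1` C).
Proof. by move=> mC; rewrite -[X in measurable X]setTI; exact: measurable_funP. Qed.

(** For an event B of V_v, independence makes 1_B - P(B) orthogonal to every event of V_u, hence to
    V_u itself. This gives E[V_u - E[V_u]; B] = 0, and [centered_uncorrelated] concludes. *)
Lemma indep_uncorrelated u v : indep V [set u]%SET [set v]%SET -> S u v = 0.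
Proof.
move=> uv; pose c := fine (\int[P]_w (V u w)%:E)%E.
have i1 (r : R) := finite_measure_integrable_cst P r measurableT.
rewrite posdef_sym// -cov_delta.
apply: (@centered_uncorrelated _ _ c); first exact: delta_neq0.
move=> C mC; rewrite !combination_delta.
set B := V v @^-1` C; have mB : measurable B by exact: mV.
have iB : P.-integrable setT (EFin \o (\1_B : T -> R)) by exact: integrable_indic.
pose p := fine (P B); have pE : p%:E = P B by rewrite fineK// fin_num_measure.
have ik : P.-integrable setT (EFin \o (fun w => \1_B w - p)).
  exact: (integrableB measurableT iB (i1 p)).
have ck D : measurable D -> centered P (fun w => \1_(V u @^-1` D) w * (\1_B w - p)).
  move=> mD; have mVD := mV u mD.
  apply/(centered_indic mVD ik).
  rewrite integralB_EFin//; [|exact: integrableS iB|exact: integrableS (i1 p)].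
  have E : P (B `&` V u @^-1` D) = (P B * P (V u @^-1` D))%E.
    rewrite setIC muleC; apply: uv;
    by apply: sigma_of_preimage => //; rewrite inE.
  rewrite integral_indic// integral_cst// pE.
  transitivity (P B * P (V u @^-1` D) - P B * P (V u @^-1` D))%E.
    by congr (_ - _)%E; exact: E.
  by rewrite subee// fin_numM// fin_num_measure.
have cVk : centered P (fun w => V u w * (\1_B w - p)).
  apply: centered_orth => //.
  have iVB := integrable_mul_indic mB (iV u).
  have := integrableB measurableT iVB (integrableZl measurableT p (iV u)).
  congr (P.-integrable setT); apply/funext => w /=.
  by rewrite -?EFinM -?EFinB; congr EFin; ring.
have c1 : centered P (fun w => \1_B w - p).
  by apply: eq_centered (ck _ measurableT) => w; rewrite preimage_setT indicT mul1r.
have cVc : centered P (fun w => V u w - c).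
  split; first exact: (integrableB measurableT (iV u) (i1 c)).
  have fVu := integrable_fin_num measurableT (iV u).
  have Ic : (\int[P]_w c%:E = c%:E)%E.
    transitivity (c%:E * P setT)%E; first exact: integral_cst.
    by rewrite probability_setT mule1.
  rewrite (integralB_EFin measurableT (iV u) (i1 c)) Ic /c fineK//.
  by rewrite subee.
(* With p = P(B): 1_B (V_u - c) = V_u (1_B - p) + p (V_u - c) - c (1_B - p). *)
have := centeredB (centeredD cVk (centeredZ p cVc)) (centeredZ c c1).
by apply: eq_centered => w; ring.
Qed.

(** For an event B of V_v with conditional probability g given V_x, write 1_B = (1_B - g) + g. The
    residual t.V of V_u given V_x is orthogonal to the first part by conditional independence, and,
    once centered, to the second because g is a function of V_x. *)
Lemma cond_indep_cov (I J : {set 'I_n}) u v x :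
  u \in I -> v \in J -> cond_indep V I J [set x]%SET ->
  S u v * S x x = S u x * S x v.
Proof.
move=> uI vJ ci; have Sxx := posdef_diag_gt0 Spd x.
pose G := sigma_of V [set x]%SET.
have mG D : G D -> measurable D by exact: measurable_sigma_of.
pose al := S u x / S x x; pose t : 'rV[R]_n := e u + (- al) *: e x.
have tE w : combination t w = V u w - al * V x w.
  by rewrite combinationD combinationZ !combination_delta mulNr.
have xt : cov S (e x) t = 0.
  rewrite (covDr Spd) (covZr Spd) !cov_delta /al (posdef_sym Spd x u).
  by rewrite mulNr divfK ?subrr// gt_eqF.
suff vt : cov S (e v) t = 0.
  move: vt; rewrite (covDr Spd) (covZr Spd) !cov_delta (posdef_sym Spd v u).
  rewrite (posdef_sym Spd v x) mulNr => /subr0_eq ->.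
  by rewrite /al mulrAC divfK// gt_eqF.
apply: (centered_uncorrelated (c := mean t)); first exact: delta_neq0.
move=> C mC; rewrite combination_delta.
set B := V v @^-1` C; have mB : measurable B by exact: mV.
have sB : sigma_of V J B by exact: sigma_of_preimage.
have sA D : measurable D -> sigma_of V I (V u @^-1` D).
  by move=> mD; exact: sigma_of_preimage.
(* The whole space serves as first event, only to fix one version g of P(B | V_x). *)
have [f0 [g [h0 [_ gP _ _]]]] := ci _ _ (sA _ measurableT) sB.
have mg := cond_prob_measurable gP.
have g01 := cond_prob_bounded mG mB gP.
have ig : P.-integrable setT (EFin \o g) by case: gP.
have iB : P.-integrable setT (EFin \o (\1_B : T -> R)) by exact: integrable_indic.
have ik : P.-integrable setT (EFin \o (fun w => \1_B w - g w)).
  exact: (integrableB measurableT iB ig).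
have imulk q : P.-integrable setT (EFin \o q) ->
    P.-integrable setT (EFin \o (fun w => q w * (\1_B w - g w))).
  move=> iq; have := integrableB measurableT (integrable_mul_indic mB iq)
    (integrable_ae_bounded_mul mg g01 iq).
  congr (P.-integrable setT); apply/funext => w /=.
  by rewrite -EFinB; congr EFin; ring.
(* The version [g'] of P(B | V_x) that comes with [A] need not be [g]. *)
have cuk : centered P (fun w => V u w * (\1_B w - g w)).
  apply: centered_orth => //; first exact: imulk.
  move=> D mD; have mA := mV u mD.
  have [f [g' [h [fP g'P hP hfg]]]] := ci _ _ (sA _ mD) sB.
  set A := V u @^-1` D in mA fP hP *.
  have mf := cond_prob_measurable fP; have f01 := cond_prob_bounded mG mA fP.
  have mg' := cond_prob_measurable g'P; have g'01 := cond_prob_bounded mG mB g'P.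
  have if_ : P.-integrable setT (EFin \o f) by case: fP.
  have ig' : P.-integrable setT (EFin \o g') by case: g'P.
  have iA : P.-integrable setT (EFin \o (\1_A : T -> R)) by exact: integrable_indic.
  have ifg q : P.-integrable setT (EFin \o q) ->
      P.-integrable setT (EFin \o (fun w => f w * q w)).
    exact: integrable_ae_bounded_mul.
  have fG : forall E : set R, measurable E -> G (f @^-1` E) by case: fP.
  have gG : forall E : set R, measurable E -> G (g @^-1` E) by case: gP.
  (* E[1_A g] = E[f g] *)
  have c1 : centered P (fun w => g w * (\1_A w - f w)).
    apply: centered_orth => //.
    - exact: (integrableB measurableT iA if_).
    - apply: integrable_ae_bounded_mul => //.
      exact: (integrableB measurableT iA if_).
    - by move=> E mE; apply: (cond_prob_centered mG mA fP); exact: gG.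
  (* E[f g] = E[f g'] *)
  have c2 : centered P (fun w => f w * (g w - g' w)).
    apply: centered_orth => //.
    - exact: (integrableB measurableT ig ig').
    - by apply: ifg; exact: (integrableB measurableT ig ig').
    - move=> E mE; have := centeredB (cond_prob_centered mG mB g'P (fG _ mE))
        (cond_prob_centered mG mB gP (fG _ mE)).
      by apply: eq_centered => w; ring.
  (* P(A /\ B) = E[f g'] *)
  have c3 : centered P (fun w => \1_A w * \1_B w - f w * g' w).
    have mAB : measurable (A `&` B) by exact: measurableI.
    have GT : G setT by rewrite -(preimage_setT g); exact: gG.
    apply: ae_eq_centered (cond_prob_centered mG mAB hP GT).
      apply: measurable_funB; apply: measurable_funM => //; exact: measurable_indic.
    by apply: filterS hfg => w /= ->; rewrite indicT mul1r indicI.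
  (* 1_A (1_B - g) = (1_A 1_B - f g') - f (g - g') - g (1_A - f). *)
  have := centeredB (centeredB c3 c2) c1.
  by apply: eq_centered => w; ring.
have cxk : centered P (fun w => V x w * (\1_B w - g w)).
  apply: centered_orth => //; first exact: imulk.
  move=> D mD; apply: (cond_prob_centered mG mB gP).
  by apply: sigma_of_preimage => //; rewrite inE.
have c1k : centered P (fun w => \1_B w - g w).
  have GT : G setT.
    rewrite -(preimage_setT (V x)).
    by apply: sigma_of_preimage => //; rewrite inE.
  by apply: eq_centered (cond_prob_centered mG mB gP GT) => w; rewrite indicT mul1r.
have iZ : P.-integrable setT (EFin \o (fun w => combination t w - mean t)).
  have i1 := finite_measure_integrable_cst P (mean t) measurableT.
  exact: (integrableB measurableT (integrable_combination t) i1).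
have cZg : centered P (fun w => g w * (combination t w - mean t)).
  apply: centered_orth => //; first exact: integrable_ae_bounded_mul.
  (* Events of g are events of V_x, with which t.V is uncorrelated. *)
  move=> D mD; have [gG _ _] := gP; have [E mE ->] := sigma_of1 (gG _ mD).
  by rewrite -combination_delta; apply: uncorrelated_centered => //; exact: delta_neq0.
(* With m the mean of t.V: 1_B (t.V - m) = (V_u - al V_x - m) (1_B - g) + g (t.V - m). *)
have := centeredD
  (centeredB (centeredB cuk (centeredZ al cxk)) (centeredZ (mean t) c1k)) cZg.
by apply: eq_centered => w; rewrite tE; ring.
Qed.

End Gaussian.

(** * Monotonicity of squared partial correlations under the independence hypotheses *)

Theorem theorem3 (d : measure_display) (T : measurableType d) (R : realType)
    (P : probability T R) (n : nat) (V : 'I_n -> {RV P >-> R})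
    (mu : 'rV[R]_n) (Sigma : 'M[R]_n)
    (hV : gaussian_vector V mu Sigma) (hSigma : posdefmx Sigma)
    (a c z : 'I_n) (B : {set 'I_n})
    (hac : a != c) (ha : a \notin (z |: B)%SET) (hc : c \notin (z |: B)%SET)
    (hindep : indep V [set a]%SET [set c]%SET)
    (hcond : exists x : 'I_n,
       cond_indep V [set a; c]%SET (z |: B)%SET [set x]%SET) :
  pcorr2 Sigma a c B <= pcorr2 Sigma a c (z |: B)%SET /\
  (forall z' : 'I_n, z' \notin [set a; c]%SET ->
     cond_indep V [set z']%SET ([set a; c] :|: B)%SET [set z]%SET ->
     pcorr2 Sigma a c B <= pcorr2 Sigma a c (z' |: B)%SET /\
     pcorr2 Sigma a c (z' |: B)%SET <= pcorr2 Sigma a c (z |: B)%SET).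
Proof.
have [x hx] := hcond.
have ac0 := indep_uncorrelated hV hSigma hindep.
have xE u v : u \in [set a; c]%SET -> v \in (z |: B)%SET ->
    Sigma u v * Sigma x x = Sigma u x * Sigma x v.
  by move=> uac vB; exact: (cond_indep_cov hV hSigma uac vB hx).
have [le1 le2] := pcorr2_monotone hSigma ha hc ac0 xE.
split=> // z' z'ac hz'; apply: le2 => // v vB.
by apply: (cond_indep_cov hV hSigma _ vB hz'); rewrite inE.
Qed.
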